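(* Let $(F_s,F_e)$ be an orean factorization of a category $\mathbb{C}$, with conormal operator $\alpha\colon F_s\to F_e$ and normal operator $\beta\colon F_e\to F_s$. Consider the conditions: (1) $F_e$ satisfies (N1); furthermore, for any morphism $f\colon X\to Y$, any $F_s$-cluster $A$ in $Y$ and any $F_e$-cluster $R$ in $Y$ such that $A\ast R=A$, $R\geq\alpha(A)$, $\mathrm{Im}^s f\geq A$ and $\mathrm{Im}^e f\geq R$, we have $(f\cdot^s(A\cdot^s f))\ast R=A$. (2) $\alpha$ preserves binary meets; furthermore, $A=A\ast\alpha(A)$ for every $F_s$-cluster $A$ and $R\geq\alpha(\beta(R))$ for every $F_e$-cluster $R$. Then (1) and (2) both hold if and only if the following two conditions both hold: (i) $F_e$ satisfies (N1); furthermore, for any $F_e$-quotient $e$ and any $F_s$-cluster $A$ in the codomain of $e$, we have $(e\cdot^s(A\cdot^s e))\ast\alpha(A)=A\ast\alpha(A)=A$. (ii) $\alpha$ preserves binary meets and bottom clusters.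
   Context: A form over a category $\mathbb{C}$ is a faithful functor $F\colon\mathbb{B}\to\mathbb{C}$ that is amnestic (an isomorphism of $\mathbb{B}$ sent to an identity morphism is an identity morphism). Objects of $\mathbb{B}$ sent to $X$ are called ($F$-)clusters in $X$. For $f\colon X\to Y$, a cluster $A$ in $X$ and a cluster $B$ in $Y$, $B\geq_f A$ means that some morphism $A\to B$ of $\mathbb{B}$ is sent to $f$; $\geq$ denotes $\geq_{1_X}$, a partial order on the clusters in $X$. $F$ is orean if: (O1) for each $X$ the clusters in $X$ form a bounded lattice ($\bot_X,\top_X,\vee,\wedge$); (O2) for $f\colon X\to Y$, $g\colon Y\to Z$, if $C\geq_{gf}A$ then there is a cluster $B$ in $Y$ with $C\geq_g B$ and $B\geq_f A$; (O3) for $f\colon X\to Y$ and a cluster $S$ in $X$ there is a least cluster $f\cdot S$ in $Y$ among those $T$ with $T\geq_f S$ (direct image), and for a cluster $T$ in $Y$ there is a largest cluster $T\cdot f$ in $X$ among those $S$ with $T\geq_f S$ (inverse image). For $f\colon X\to Y$ put $\mathrm{Im} f=f\cdot\top_X$, $\mathrm{Ker} f=\bot_Y\cdot f$. A cluster is conormal (normal) if it is the image (kernel) of some morphism. An orean form is conormal (normal) if all its clusters are. Superscripts $s$, $e$ indicate that a construction is taken in $F_s$, $F_e$. An operator $\tau\colon F\to G$ between forms over $\mathbb{C}$ is a map of clusters over each object such that $B\geq_f A$ implies $\tau B\geq_f\tau A$. An operator of orean forms is conormal if $\tau(\mathrm{Im}^F f)=\mathrm{Im}^G f$ for all $f$,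 and normal if $\tau(\mathrm{Ker}^F f)=\mathrm{Ker}^G f$ for all $f$. For an orean form, an embedding of a conormal cluster $S$ in $X$ is a morphism $m\colon W\to X$ with $\mathrm{Im}\, m=S$ such that every $m'\colon W'\to X$ with $\mathrm{Im}\, m'\leq S$ factors uniquely as $m'=mg$; it is denoted $\iota_S$. A quotient of a normal cluster $S$ in $X$ is a morphism $q\colon X\to Y$ with $\mathrm{Ker}\, q=S$ such that every $q'\colon X\to Y'$ with $\mathrm{Ker}\, q'\geq S$ factors uniquely as $q'=hq$; it is denoted $\pi_S$. An orean form satisfies (N1) if for every $f\colon X\to Y$, $(f\cdot S)\cdot f=S\vee\mathrm{Ker} f$ for all clusters $S$ in $X$, and $f\cdot(T\cdot f)=T\wedge\mathrm{Im} f$ for all clusters $T$ in $Y$. An $F_e$-quotient is a morphism that is a quotient of some normal $F_e$-cluster. An orean factorization of $\mathbb{C}$ is an ordered pair $(F_s,F_e)$ where $F_s$ is a conormal orean form and $F_e$ a normal orean form over $\mathbb{C}$ such that every morphism $f$ factors as $f=me$ with $m$ an $F_s$-embedding of $\mathrm{Im}^s f$ and $e$ an $F_e$-quotient of $\mathrm{Ker}^e f$. For an orean factorization there are a unique conormal operator $\alpha\colon F_s\to F_e$, given by $\alpha(A)=\mathrm{Im}^e\iota^s_A$, and a unique normal operator $\beta\colon F_e\to F_s$, given by $\beta(R)=\mathrm{Ker}^s\pi^e_R$. For an $F_s$-cluster $A$ and an $F_e$-cluster $R$ in the same object, the Wyler join is $A\ast R=(\pi^e_R\cdot^s A)\cdot^s\pi^e_R$.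 *)

(* Defs.v *)
From Stdlib Require Import IndefiniteDescription.

Set Implicit Arguments.
Unset Strict Implicit.
Unset Printing Implicit Defensive.

Record category := Category {
  obj :> Type;
  hom : obj -> obj -> Type;
  idm : forall X, hom X X;
  comp : forall X Y Z, hom Y Z -> hom X Y -> hom X Z;
  comp1m : forall X Y (f : hom X Y), comp (idm Y) f = f;
  compm1 : forall X Y (f : hom X Y), comp f (idm X) = f;
  compA : forall X Y Z W (f : hom X Y) (g : hom Y Z) (h : hom Z W),
    comp h (comp g f) = comp (comp h g) f
}.

Arguments hom {C} X Y : rename.
Arguments idm {C} X : rename.
Arguments comp {C X Y Z} g f : rename.

Notation "g \oc f" := (comp g f) (at level 40, left associativity).

Definition hom_cast (C : category) (X X' Y Y' : C) (p : X = X') (q : Y = Y')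
    (f : hom X Y) : hom X' Y' :=
  match p in _ = x, q in _ = y return hom x y with
  | eq_refl, eq_refl => f
  end.

Definition is_iso (C : category) (X Y : C) (f : hom X Y) : Prop :=
  exists g : hom Y X, g \oc f = idm X /\ f \oc g = idm Y.

Definition is_identity (C : category) (X Y : C) (f : hom X Y) : Prop :=
  exists p : X = Y, f = hom_cast eq_refl p (idm X).

Record functor (B C : category) := Functor {
  fobj :> B -> C;
  fmap : forall X Y : B, hom X Y -> hom (fobj X) (fobj Y);
  fmap1 : forall X : B, fmap (idm X) = idm (fobj X);
  fmapM : forall (X Y Z : B) (f : hom X Y) (g : hom Y Z),
    fmap (g \oc f) = fmap g \oc fmap f
}.

Arguments fmap {B C} F {X Y} _ : rename.

Definition faithful (B C : category) (F : functor B C) : Prop :=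
  forall (X Y : B) (u v : hom X Y), fmap F u = fmap F v -> u = v.

Definition amnestic (B C : category) (F : functor B C) : Prop :=
  forall (X Y : B) (u : hom X Y),
    is_iso u -> is_identity (fmap F u) -> is_identity u.

Record form (C : category) := Form {
  form_dom : category;
  form_fun : functor form_dom C;
  form_faithful : faithful form_fun;
  form_amnestic : amnestic form_fun
}.

Definition cluster (C : category) (F : form C) (X : C) : Type :=
  {A : form_dom F | form_fun F A = X}.

(* [geq f B A] is B >=_f A: some morphism from A to B is sent to f. The cast
   transports its image along the equations placing A over X and B over Y. *)
Definition geq (C : category) (F : form C) (X Y : C) (f : hom X Y)
    (B : cluster F Y) (A : cluster F X) : Prop :=
  exists u : hom (proj1_sig A) (proj1_sig B),
    hom_cast (proj2_sig A) (proj2_sig B) (fmap (form_fun F) u) = f.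

Definition cge (C : category) (F : form C) (X : C) (B A : cluster F X) : Prop :=
  geq (idm X) B A.

(* The bounds, lattice operations and images are carried as data, but since
   [cge] is antisymmetric their specifications determine them uniquely. *)
Record orean_form (C : category) := OreanForm {
  oform :> form C;

  bot : forall X, cluster oform X;
  top : forall X, cluster oform X;
  join : forall X, cluster oform X -> cluster oform X -> cluster oform X;
  meet : forall X, cluster oform X -> cluster oform X -> cluster oform X;
  bot_least : forall X (A : cluster oform X), cge A (bot X);
  top_greatest : forall X (A : cluster oform X), cge (top X) A;
  join_ubl : forall X (A B : cluster oform X), cge (join A B) A;
  join_ubr : forall X (A B : cluster oform X), cge (join A B) B;
  join_least : forall X (A B D : cluster oform X),
    cge D A -> cge D B -> cge D (join A B);
  meet_lbl : forall X (A B : cluster oform X), cge A (meet A B);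
  meet_lbr : forall X (A B : cluster oform X), cge B (meet A B);
  meet_greatest : forall X (A B D : cluster oform X),
    cge A D -> cge B D -> cge (meet A B) D;

  geq_split : forall (X Y Z : C) (f : hom X Y) (g : hom Y Z)
      (A : cluster oform X) (D : cluster oform Z),
    geq (g \oc f) D A ->
    exists B : cluster oform Y, geq g D B /\ geq f B A;

  dirim : forall X Y : C, hom X Y -> cluster oform X -> cluster oform Y;
  invim : forall X Y : C, cluster oform Y -> hom X Y -> cluster oform X;
  dirim_geq : forall (X Y : C) (f : hom X Y) (S : cluster oform X),
    geq f (dirim f S) S;
  dirim_least : forall (X Y : C) (f : hom X Y) (S : cluster oform X)
      (T : cluster oform Y),
    geq f T S -> cge T (dirim f S);
  invim_geq : forall (X Y : C) (f : hom X Y) (T : cluster oform Y),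
    geq f T (invim T f);
  invim_greatest : forall (X Y : C) (f : hom X Y) (T : cluster oform Y)
      (S : cluster oform X),
    geq f T S -> cge (invim T f) S
}.

Arguments bot {C} F X : rename.
Arguments top {C} F X : rename.
Arguments join {C F X} A B : rename.
Arguments meet {C F X} A B : rename.
Arguments dirim {C F X Y} f S : rename.
Arguments invim {C F X Y} T f : rename.

Definition im (C : category) (F : orean_form C) (X Y : C) (f : hom X Y) :
    cluster F Y :=
  dirim f (top F X).

Definition ker (C : category) (F : orean_form C) (X Y : C) (f : hom X Y) :
    cluster F X :=
  invim (bot F Y) f.

Arguments im {C} F {X Y} f.
Arguments ker {C} F {X Y} f.

Definition conormal_cluster (C : category) (F : orean_form C) (X : C)
    (S : cluster F X) : Prop :=
  exists (W : C) (f : hom W X), im F f = S.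

Definition normal_cluster (C : category) (F : orean_form C) (X : C)
    (S : cluster F X) : Prop :=
  exists (Y : C) (f : hom X Y), ker F f = S.

Definition conormal_form (C : category) (F : orean_form C) : Prop :=
  forall (X : C) (S : cluster F X), conormal_cluster S.

Definition normal_form (C : category) (F : orean_form C) : Prop :=
  forall (X : C) (S : cluster F X), normal_cluster S.

Record operator (C : category) (F G : form C) := Operator {
  op_map :> forall X : C, cluster F X -> cluster G X;
  op_mono : forall (X Y : C) (f : hom X Y) (A : cluster F X) (B : cluster F Y),
    geq f B A -> geq f (op_map B) (op_map A)
}.

Arguments op_map {C F G} tau X _ : rename.

Definition conormal_operator (C : category) (F G : orean_form C)
    (tau : operator F G) : Prop :=
  forall (X Y : C) (f : hom X Y), tau Y (im F f) = im G f.

Definition normal_operator (C : category) (F G : orean_form C)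
    (tau : operator F G) : Prop :=
  forall (X Y : C) (f : hom X Y), tau X (ker F f) = ker G f.

Definition preserves_meets (C : category) (F G : orean_form C)
    (tau : operator F G) : Prop :=
  forall (X : C) (A B : cluster F X),
    tau X (meet A B) = meet (tau X A) (tau X B).

Definition preserves_bottoms (C : category) (F G : orean_form C)
    (tau : operator F G) : Prop :=
  forall X : C, tau X (bot F X) = bot G X.

Definition is_embedding (C : category) (F : orean_form C) (X : C)
    (S : cluster F X) (W : C) (m : hom W X) : Prop :=
  im F m = S /\
  forall (W' : C) (m' : hom W' X), cge S (im F m') ->
    exists! g : hom W' W, m' = m \oc g.

Definition is_quotient (C : category) (F : orean_form C) (X : C)
    (S : cluster F X) (Y : C) (q : hom X Y) : Prop :=
  ker F q = S /\
  forall (Y' : C) (q' : hom X Y'), cge (ker F q') S ->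
    exists! h : hom Y Y', q' = h \oc q.

Definition quotient_morphism (C : category) (F : orean_form C) (X Y : C)
    (q : hom X Y) : Prop :=
  exists S : cluster F X, normal_cluster S /\ is_quotient S q.

Arguments quotient_morphism {C} F {X Y} q.

Definition N1 (C : category) (F : orean_form C) : Prop :=
  forall (X Y : C) (f : hom X Y),
    (forall S : cluster F X, invim (dirim f S) f = join S (ker F f)) /\
    (forall T : cluster F Y, dirim f (invim T f) = meet T (im F f)).

Record orean_factorization (C : category) (Fs Fe : orean_form C) : Prop :=
  OreanFactorization {
    fact_conormal : conormal_form Fs;
    fact_normal : normal_form Fe;
    fact_factors : forall (X Y : C) (f : hom X Y),
      exists (W : C) (e : hom X W) (m : hom W Y),
        f = m \oc e /\ is_embedding (im Fs f) m /\ is_quotient (ker Fe f) e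
  }.

Lemma quotient_exists (C : category) (Fs Fe : orean_form C)
    (P : orean_factorization Fs Fe) (X : C) (R : cluster Fe X) :
  exists q : {Y : C & hom X Y}, is_quotient R (projT2 q).
Proof.
destruct (fact_normal P R) as [Y [f kf]].
destruct (fact_factors P f) as [W [e [m [_ [_ qe]]]]].
exists (existT _ W e); simpl.
rewrite <- kf; exact qe.
Qed.

(* A choice of quotient of R; quotients of the same cluster differ by a unique
   isomorphism. *)
Definition quotient (C : category) (Fs Fe : orean_form C)
    (P : orean_factorization Fs Fe) (X : C) (R : cluster Fe X) :
    {q : {Y : C & hom X Y} | is_quotient R (projT2 q)} :=
  constructive_indefinite_description _ (quotient_exists P R).

Definition quot_obj (C : category) (Fs Fe : orean_form C)
    (P : orean_factorization Fs Fe) (X : C) (R : cluster Fe X) : C :=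
  projT1 (proj1_sig (quotient P R)).

Definition quot_map (C : category) (Fs Fe : orean_form C)
    (P : orean_factorization Fs Fe) (X : C) (R : cluster Fe X) :
    hom X (quot_obj P R) :=
  projT2 (proj1_sig (quotient P R)).

Definition wyler_join (C : category) (Fs Fe : orean_form C)
    (P : orean_factorization Fs Fe) (X : C)
    (A : cluster Fs X) (R : cluster Fe X) : cluster Fs X :=
  invim (dirim (quot_map P R) A) (quot_map P R).

(* Main.v *)
(* An F_e-quotient has full F_s-image, since its factorization (embedding after
   quotient) differs from it by an isomorphism; so (i) is the case R = alpha A
   of (1).  Conversely, let f = m e be the factorization of f and B = A . m,
   C = e . (B . e), so that A = m . B and f . (A . f) = m . C.  Condition (i)
   says that B and C have the same image under the quotient of alpha B; since
   m maps alpha B below R, the composite of m with the quotient of R factors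
   through that quotient, so A and m . C have the same image under the quotient
   of R. *)

From Stdlib Require Import Eqdep.
Require Import Defs.

Set Implicit Arguments.
Unset Strict Implicit.
Unset Printing Implicit Defensive.

(** [Y] is a variable here, so [q] can be eliminated; in [cge_antisym] both ends are values of
    [form_fun]. *)
Lemma hom_cast_inverse (C : category) (X Y : C) (q : Y = X)
    (f : hom X Y) (g : hom Y X) :
  hom_cast eq_refl q f = idm X -> hom_cast q eq_refl g = idm X ->
  g \oc f = idm X /\ f \oc g = idm Y.
Proof. destruct q; simpl; intros -> ->; split; apply comp1m. Qed.

Lemma hom_cast_identity (C : category) (X Y : C) (q : Y = X) (f : hom X Y) :
  hom_cast eq_refl q f = idm X -> is_identity f.
Proof. destruct q; simpl; intros ->; exists eq_refl; reflexivity. Qed.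

Section Forms.

Variables (C : category) (F : form C).

Lemma geq_id (X : C) (A : cluster F X) : cge A A.
Proof.
destruct A as [a p]; destruct p; exists (idm a); simpl; apply fmap1.
Qed.

Lemma geq_comp (X Y Z : C) (f : hom X Y) (g : hom Y Z)
    (A : cluster F X) (B : cluster F Y) (D : cluster F Z) :
  geq g D B -> geq f B A -> geq (g \oc f) D A.
Proof.
destruct A as [a p], B as [b q], D as [d r]; destruct p, q, r.
intros [v <-] [u <-]; exists (v \oc u); simpl in *; apply fmapM.
Qed.

Lemma cge_trans (X : C) (A B D : cluster F X) : cge A B -> cge B D -> cge A D.
Proof.
intros AB BD; unfold cge; rewrite <- (comp1m (idm X)); exact (geq_comp AB BD).
Qed.

Lemma geq_cge (X Y : C) (f : hom X Y) (A A' : cluster F X) (B B' : cluster F Y) :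
  cge B' B -> geq f B A -> cge A A' -> geq f B' A'.
Proof.
intros BB BA AA; rewrite <- (compm1 f), <- (comp1m (f \oc idm X)).
exact (geq_comp BB (geq_comp BA AA)).
Qed.

(* Amnesticity identifies the underlying objects; equality of the proofs that
   they lie over [X] is UIP. *)
Lemma cge_antisym (X : C) (A B : cluster F X) : cge A B -> cge B A -> A = B.
Proof.
destruct A as [a p]; destruct p; destruct B as [b q].
intros [v Hv] [u Hu]; simpl in *.
destruct (hom_cast_inverse Hu Hv) as [vu uv].
assert (iso_u : is_iso u).
{ exists v; split; apply (form_faithful (f := F)); rewrite fmapM, fmap1; assumption. }
destruct (form_amnestic iso_u (hom_cast_identity Hu)) as [r _].
destruct r; rewrite (UIP _ _ _ q eq_refl); reflexivity.
Qed.

End Forms.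

Section OreanForms.

Variables (C : category) (F : orean_form C).

Lemma cge_dirim (X Y : C) (f : hom X Y) (S : cluster F X) (T : cluster F Y) :
  cge T (dirim f S) <-> geq f T S.
Proof.
split; [intros H | apply dirim_least].
exact (geq_cge H (dirim_geq f S) (geq_id S)).
Qed.

Lemma invim_cge (X Y : C) (f : hom X Y) (S : cluster F X) (T : cluster F Y) :
  cge (invim T f) S <-> geq f T S.
Proof.
split; [intros H | apply invim_greatest].
exact (geq_cge (geq_id T) (invim_geq f T) H).
Qed.

Lemma dirim_mono (X Y : C) (f : hom X Y) (S S' : cluster F X) :
  cge S S' -> cge (dirim f S) (dirim f S').
Proof.
intros H; apply cge_dirim; exact (geq_cge (geq_id _) (dirim_geq f S) H).
Qed.

Lemma invim_mono (X Y : C) (f : hom X Y) (T T' : cluster F Y) :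
  cge T T' -> cge (invim T f) (invim T' f).
Proof.
intros H; apply invim_cge; exact (geq_cge H (invim_geq f T') (geq_id _)).
Qed.

Lemma dirim_invim_cge (X Y : C) (f : hom X Y) (T : cluster F Y) :
  cge T (dirim f (invim T f)).
Proof. apply cge_dirim, invim_geq. Qed.

Lemma dirim_invim_dirim (X Y : C) (f : hom X Y) (S : cluster F X) :
  dirim f (invim (dirim f S) f) = dirim f S.
Proof.
apply cge_antisym.
- apply dirim_mono, invim_cge, dirim_geq.
- apply dirim_invim_cge.
Qed.

(** The first inequality is (O2): the intermediate cluster it provides lies above [dirim f S]. The
    second is composition of [geq]. *)
Lemma dirim_comp (X Y Z : C) (f : hom X Y) (g : hom Y Z) (S : cluster F X) :
  dirim (g \oc f) S = dirim g (dirim f S).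
Proof.
apply cge_antisym.
- destruct (geq_split (dirim_geq (g \oc f) S)) as [B [gB fB]].
  apply cge_dirim; exact (geq_cge (geq_id _) gB (proj2 (cge_dirim f S B) fB)).
- apply cge_dirim; exact (geq_comp (dirim_geq g _) (dirim_geq f S)).
Qed.

Lemma invim_comp (X Y Z : C) (f : hom X Y) (g : hom Y Z) (T : cluster F Z) :
  invim T (g \oc f) = invim (invim T g) f.
Proof.
apply cge_antisym.
- apply invim_cge; exact (geq_comp (invim_geq g T) (invim_geq f _)).
- destruct (geq_split (invim_geq (g \oc f) T)) as [B [gB fB]].
  apply invim_cge; exact (geq_cge (proj2 (invim_cge g B T) gB) fB (geq_id _)).
Qed.

Lemma im_id (X : C) : im F (idm X) = top F X.
Proof.
apply cge_antisym; [apply dirim_geq | apply top_greatest].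
Qed.

(** The identity factors through [m], so its image, the top, lies below that of [m]. *)
Lemma im_split_epi (X Y : C) (m : hom X Y) (n : hom Y X) :
  m \oc n = idm Y -> im F m = top F Y.
Proof.
intros mn; apply cge_antisym; [| apply top_greatest].
rewrite <- im_id, <- mn; unfold im at 2; rewrite dirim_comp.
apply dirim_mono, top_greatest.
Qed.

Lemma is_quotient_id (X : C) : is_quotient (ker F (idm X)) (idm X).
Proof.
split; [reflexivity | intros Y q _].
exists q; split; [symmetry; apply compm1 | intros h ->; apply compm1].
Qed.

(** Since [q'] has kernel [R], it factors as [n \oc q]; then [m \oc n \oc q = q], and uniqueness of
    factorizations through [q] cancels [q]. *)
Lemma quotient_split_epi (X Y Y' : C) (R : cluster F X)
    (q : hom X Y) (q' : hom X Y') (m : hom Y' Y) :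
  is_quotient R q -> is_quotient R q' -> q = m \oc q' ->
  exists n, m \oc n = idm Y.
Proof.
intros [kq uq] [kq' uq'] E.
destruct (uq _ q') as [n [En _]].
{ rewrite kq'; apply geq_id. }
exists n.
destruct (uq _ q) as [h [Eh uh]].
{ rewrite kq; apply geq_id. }
rewrite <- (uh (idm Y)), (uh (m \oc n)); trivial.
- now rewrite <- compA, <- En.
- now rewrite comp1m.
Qed.

End OreanForms.

Section Factorization.

Variables (C : category) (Fs Fe : orean_form C).
Variable P : orean_factorization Fs Fe.

Lemma quot_mapP (X : C) (R : cluster Fe X) : is_quotient R (quot_map P R).
Proof. exact (proj2_sig (quotient P R)). Qed.

Lemma im_quotient (X Y : C) (e : hom X Y) :
  quotient_morphism Fe e -> im Fs e = top Fs Y.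
Proof.
intros [R [_ qR]].
destruct (fact_factors P e) as [W [e' [m [E [[mI _] qe']]]]].
rewrite (proj1 qR) in qe'.
destruct (quotient_split_epi qR qe' E) as [n mn].
rewrite <- mI; exact (im_split_epi Fs mn).
Qed.

(** [h] factors through the quotient of [R], which has the same direct image on [A] and on its Wyler
    join with [R]. *)
Lemma dirim_wyler_join (X Y : C) (h : hom X Y)
    (A : cluster Fs X) (R : cluster Fe X) :
  cge (ker Fe h) R -> dirim h (wyler_join P A R) = dirim h A.
Proof.
intros hR; destruct (proj2 (quot_mapP R) _ h hR) as [g [E _]].
unfold wyler_join.
rewrite E, !dirim_comp, dirim_invim_dirim; reflexivity.
Qed.

(** By conormality [A] is the image of some [a], which factors as [m \oc g]; the image of [g] lies
    below [invim A m]. *)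
Lemma dirim_invim_embedding (X Y : C) (S A : cluster Fs Y) (m : hom X Y) :
  is_embedding S m -> cge S A -> dirim m (invim A m) = A.
Proof.
intros [_ um] SA; apply cge_antisym; [| apply dirim_invim_cge].
destruct (fact_conormal P A) as [V [a <-]].
destruct (um _ a SA) as [g [-> _]].
unfold im; rewrite dirim_comp.
apply dirim_mono, invim_cge, dirim_geq.
Qed.

Variable alpha : operator Fs Fe.

Lemma conormal_operator_top (X : C) :
  conormal_operator alpha -> alpha X (top Fs X) = top Fe X.
Proof. intros H; rewrite <- !im_id; apply H. Qed.

(** [alpha] carries the relation between [ker Fs f] and the bottom along [f] over to [Fe], where the
    bottom is again the bottom. *)
Lemma alpha_ker_cge (X Y : C) (f : hom X Y) :
  conormal_operator alpha -> preserves_bottoms alpha ->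
  cge (ker Fe f) (alpha X (ker Fs f)).
Proof.
intros ac ab; apply invim_cge; rewrite <- ab.
apply op_mono, invim_geq.
Qed.

Lemma wyler_join_dirim_invim (X Y : C) (f : hom X Y)
    (A : cluster Fs Y) (R : cluster Fe Y) :
  (forall (V W : C) (e : hom V W), quotient_morphism Fe e ->
     forall B : cluster Fs W,
       wyler_join P (dirim e (invim B e)) (alpha W B) = B) ->
  wyler_join P A R = A -> cge R (alpha Y A) -> cge (im Fs f) A ->
  wyler_join P (dirim f (invim A f)) R = A.
Proof.
intros He AR RA fA.
destruct (fact_factors P f) as [W [e [m [-> [em qe]]]]].
pose proof (dirim_invim_embedding em fA) as mB.
set (B := invim A m) in *.
assert (qm : quotient_morphism Fe e).
{ exists (ker Fe (m \oc e)); split; [apply (fact_normal P) | exact qe]. }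
specialize (He _ _ e qm B).
rewrite invim_comp, dirim_comp; fold B.
(* This kernel is the inverse image of [R] along [m], and [m] maps [alpha W B] below [alpha Y A],
   hence below [R]. *)
assert (K : cge (ker Fe (quot_map P R \oc m)) (alpha W B)).
{ unfold ker; rewrite invim_comp.
  apply invim_cge.
  change (invim (bot Fe _) (quot_map P R)) with (ker Fe (quot_map P R)).
  rewrite (proj1 (quot_mapP R)).
  apply (geq_cge RA (op_mono alpha (invim_geq m A)) (geq_id _)). }
pose proof (dirim_wyler_join (dirim e (invim B e)) K) as E.
(* [E] becomes the equality of the direct images of [A] and of [dirim m (dirim e (invim B e))] under
   the quotient of [R]. *)
rewrite He, !dirim_comp, mB in E.
rewrite <- AR; unfold wyler_join; rewrite <- E; reflexivity.
Qed.

End Factorization.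

Theorem theorem165 (C : category) (Fs Fe : orean_form C)
    (P : orean_factorization Fs Fe)
    (alpha : operator Fs Fe) (alpha_conormal : conormal_operator alpha)
    (beta : operator Fe Fs) (beta_normal : normal_operator beta) :
  ((N1 Fe /\
    forall (X Y : C) (f : hom X Y) (A : cluster Fs Y) (R : cluster Fe Y),
      wyler_join P A R = A -> cge R (alpha Y A) ->
      cge (im Fs f) A -> cge (im Fe f) R ->
      wyler_join P (dirim f (invim A f)) R = A)
   /\
   (preserves_meets alpha /\
    (forall (X : C) (A : cluster Fs X), A = wyler_join P A (alpha X A)) /\
    (forall (X : C) (R : cluster Fe X), cge R (alpha X (beta X R)))))
  <->
  ((N1 Fe /\
    forall (X Y : C) (e : hom X Y), quotient_morphism Fe e ->
      forall A : cluster Fs Y,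
        wyler_join P (dirim e (invim A e)) (alpha Y A)
          = wyler_join P A (alpha Y A) /\
        wyler_join P A (alpha Y A) = A)
   /\
   (preserves_meets alpha /\ preserves_bottoms alpha)).
Proof.
split.
- intros [[n1 H1] [am [aA aR]]]; split; split; trivial.
  + intros X Y e qe A; split; [| symmetry; apply aA].
    rewrite <- aA; apply H1.
    * symmetry; apply aA.
    * apply geq_id.
    * rewrite (im_quotient P qe); apply top_greatest.
    (* The [Fe]-image of [e] is [alpha] of its [Fs]-image, hence of the top. *)
    * rewrite <- alpha_conormal, (im_quotient P qe),
        (conormal_operator_top _ alpha_conormal).
      apply top_greatest.
  + intros X; apply cge_antisym; [apply bot_least |].
    (* The bottom lies above [alpha (beta bot)], which lies above [alpha bot]. *)
    refine (cge_trans (aR X (bot Fe X)) _); apply op_mono, bot_least.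
- intros [[n1 He] [am ab]]; split; split; trivial; [| split].
  + intros X Y f A R AR RA fA _.
    apply (wyler_join_dirim_invim (alpha := alpha)); trivial.
    intros V W e qe B; destruct (He V W e qe B) as [-> E]; exact E.
  + intros X A; symmetry.
    (* The identity is an [Fe]-quotient with codomain [X], so (i) applies to [A]. *)
    apply (He X X (idm X)).
    exists (ker Fe (idm X)); split; [apply (fact_normal P) | apply is_quotient_id].
  (* With [R] the [Fe]-kernel of [f], [beta X R] is its [Fs]-kernel. *)
  + intros X R; destruct (fact_normal P R) as [Y [f <-]].
    rewrite beta_normal; apply alpha_ker_cge; trivial.
Qed.
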